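(* Let $G$ be a finite group. Then $G$ is $(2,6)$-centralizer if and only if either $G\cong A_4$, or $Z(G)\neq 1$ and $\frac{G}{Z(G)}$ is isomorphic to $\mathbb{Z}_3\times\mathbb{Z}_3$ or $S_3$. Moreover, $G$ is primitive $(2,6)$-centralizer if and only if $G\cong A_4$.
   Context: All groups are finite. $Z(G)$ denotes the center of $G$. For a group $G$, $2\text{-}Cent(G) = \{ C_G(\{x,y\}) \mid x,y\in G,\ x\neq y\}$, where $C_G(\{x,y\}) = C_G(x)\cap C_G(y)$. A group $G$ is called $(2,n)$-centralizer if $|2\text{-}Cent(G)| = n$, and primitive $(2,n)$-centralizer if $|2\text{-}Cent(G)| = |2\text{-}Cent(G/Z(G))| = n$. $A_n$ and $S_n$ are the alternating and symmetric groups of degree $n$ and $\mathbb{Z}_n$ is the cyclic group of order $n$. *)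

(* Defs.v *)
From mathcomp Require Import all_boot all_fingroup all_algebra all_solvable.

Set Implicit Arguments.
Unset Strict Implicit.
Unset Printing Implicit Defensive.

Import GroupScope.

Definition two_cent (gT : finGroupType) (G : {group gT}) : {set {set gT}} :=
  [set 'C_G([set x; y]) | x in G, y in G & x != y].

Definition two_centralizer (n : nat) (gT : finGroupType) (G : {group gT}) : Prop :=
  #|two_cent G| = n.

Definition primitive_two_centralizer
    (n : nat) (gT : finGroupType) (G : {group gT}) : Prop :=
  #|two_cent G| = n /\ #|two_cent (G / 'Z(G))| = n.

(* Main.v *)
(** Let [k] be the number of centralizers of noncentral elements. These are
    never closed under intersection, for otherwise 'Z(G) would be one of them,
    so the group has at least [k + 1] proper 2-centralizers; G itself is a
    2-centralizer exactly when 'Z(G) is nontrivial. Hence six 2-centralizers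
    force [k <= 5], and this makes all the proper centralizers abelian. They
    then meet pairwise in 'Z(G) and partition G outside 'Z(G), and the
    2-centralizers are the [k] centralizers, 'Z(G), and possibly G. Writing
    [n] and [b_i] for the indices of 'Z(G) in G and in the centralizers,
    [n - 1] is the sum of the [b_i - 1], each [b_i] divides [n], and
    [b_i b_j <= n], whence [b_i < k]. For [k = 4] this leaves [n = 6] or
    [n = 9]; for [k = 5] and trivial center it leaves a group of order 12
    without normal subgroup of order 3, which is A_4 by its action on the
    cosets of a Sylow 3-subgroup. *)

Require Import Defs.
From mathcomp Require Import all_boot all_fingroup all_algebra all_solvable.
From mathcomp Require Import zify.

Import GroupScope.

(** * Embeddings into symmetric groups *)

Lemma faithful_perm_rep {gT : finGroupType} {T : finType}
    (to : {action gT &-> T}) (G : {group gT}) (S : {set T}) (m : nat) :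
    [acts G, on S | to] -> 'C_G(S | to) = 1 -> #|S| = m ->
  exists f : {morphism G >-> {perm 'I_m}}, 'injm f.
Proof.
move=> actS faithS <-.
have toS g (i : 'I_#|S|) : g \in G -> to (enum_val i) g \in S.
  by move=> Gg; rewrite (acts_act actS) ?enum_valP.
(* [enum_rank_in] needs a point of [S]; if there is none, faithfulness makes [G] trivial. *)
have [S0|[s0 Ss0]] := set_0Vmem S.
  have G1 : G :=: 1.
    by rewrite -faithS; apply/esym/setIidPl/subsetP=> g _; apply/astabP=> x; rewrite S0 inE.
  have fM : {in G &, {morph (fun=> 1 : {perm 'I_#|S|}) : x y / x * y}}.
    by move=> x y _ _; rewrite mulg1.
  by exists (Morphism fM); apply/subsetP=> x /dom_ker; rewrite G1.
pose F g (i : 'I_#|S|) := enum_rank_in Ss0 (to (enum_val i) g).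
have FK g i : g \in G -> enum_val (F g i) = to (enum_val i) g.
  by move=> Gg; rewrite enum_rankK_in ?toS.
have Finj g : g \in G -> injective (F g).
  move=> Gg i j /(congr1 enum_val); rewrite !FK // => /act_inj.
  exact: enum_val_inj.
(* Outside [G] the map [F g] may fail to be injective; the default 1 is never evaluated on [G]. *)
pose f g : {perm 'I_#|S|} :=
  if injectiveP (F g) is ReflectT inj then perm inj else 1.
have fE g i : g \in G -> f g i = F g i.
  rewrite /f => Gg; case: (injectiveP (F g)) => [inj|[]]; last exact: Finj.
  exact: permE.
have fM : {in G &, {morph f : x y / x * y}}.
  move=> x y Gx Gy; apply/permP=> i; rewrite permM !fE ?groupM //.
  by apply: enum_val_inj; rewrite !FK ?groupM // actM.
exists (Morphism fM); apply/subsetP=> g kg; rewrite -faithS inE (dom_ker kg).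
have Gg := dom_ker kg; apply/astabP=> x Sx.
have/permP/(_ (enum_rank_in Ss0 x)) := mker kg.
by rewrite /= fE // perm1 => /(congr1 enum_val); rewrite FK // enum_rankK_in.
Qed.

(** The kernel of right translation on the cosets of [H] is the core of [H]. *)
Lemma coset_perm_rep {gT : finGroupType} (G H : {group gT}) (m : nat) :
    H \subset G -> gcore H G = 1 -> #|G : H| = m ->
  exists f : {morphism G >-> {perm 'I_m}}, 'injm f.
Proof.
move=> sHG core1 iGH.
apply: (@faithful_perm_rep _ _ 'Rs%act G (rcosets H G)) iGH.
  exact/atrans_acts/transRs_rcosets.
by rewrite astabRs_rcosets core1 setIg1.
Qed.

(** * Proper centralizers and 2-centralizers *)

Definition proper_cents {gT : finGroupType} (G : {group gT}) : {set {set gT}} :=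
  [set 'C_G[x] | x in G :\: 'Z(G)].

Definition centralizer_abelian {gT : finGroupType} (G : {group gT}) : Prop :=
  {in G :\: 'Z(G), forall x, abelian 'C_G[x]}.

Lemma mem_subcent1 {gT : finGroupType} {G : {group gT}} {x : gT} :
  x \in G -> x \in 'C_G[x].
Proof. by move=> Gx; rewrite inE Gx cent1id. Qed.

Lemma mem_center_subcent1 {gT : finGroupType} {G : {group gT}} {x : gT} :
  x \in G -> (x \in 'Z(G)) = ('C_G[x] == G).
Proof. by move=> Gx; rewrite in_setI Gx -sub_cent1; apply/idP/eqP => /setIidPl. Qed.

Lemma center_sub_subcent1 {gT : finGroupType} {G : {group gT}} {x : gT} :
  x \in G -> 'Z(G) \subset 'C_G[x].
Proof. by move=> Gx; rewrite setIS // -cent_set1 centS ?sub1set. Qed.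

Lemma subcent_pair {gT : finGroupType} (G : {group gT}) (x y : gT) :
  'C_G([set x; y]) = 'C_G[x] :&: 'C_G[y].
Proof. by rewrite centU !cent_set1 -setIIr. Qed.

Lemma proper_centsP {gT : finGroupType} {G : {group gT}} {A : {set gT}} :
  reflect (exists x, [/\ x \in G, x \notin 'Z(G) & A = 'C_G[x]])
          (A \in proper_cents G).
Proof.
apply: (iffP imsetP) => [[x /setDP[Gx nZx] ->]|[x [Gx nZx ->]]]; exists x => //.
by rewrite inE nZx.
Qed.

Lemma center_notin_proper_cents {gT : finGroupType} (G : {group gT}) :
  'Z(G) \notin proper_cents G.
Proof.
apply/proper_centsP=> -[x [Gx nZx eZ]]; case/negP: nZx.
by rewrite eZ mem_subcent1.
Qed.

Lemma group_notin_proper_cents {gT : finGroupType} (G : {group gT}) :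
  (G : {set gT}) \notin proper_cents G.
Proof.
apply/proper_centsP=> -[x [Gx nZx eG]]; case/negP: nZx.
by rewrite mem_center_subcent1 // -eG.
Qed.

Lemma proper_cents_sub_two_cent {gT : finGroupType} (G : {group gT}) :
  proper_cents G \subset two_cent G.
Proof.
apply/subsetP=> _ /proper_centsP[x [Gx nZx ->]].
apply/imset2P; exists x 1; rewrite ?inE ?Gx //.
  by rewrite group1; apply: contraNneq nZx => ->.
by rewrite subcent_pair cent11T setIT; apply/esym/setIidPl; rewrite subsetIl.
Qed.

(** Here the condition [x != y] matters: two distinct central elements have a nontrivial central
    quotient, and conversely a nontrivial central element is paired with 1. *)
Lemma group_in_two_cent {gT : finGroupType} (G : {group gT}) :
  ((G : {set gT}) \in two_cent G) = ('Z(G) != 1).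
Proof.
apply/imset2P/trivgPn => [[x y Gx /setIdP[Gy neqxy]] | [z Zz nz1]].
  rewrite subcent_pair => eG.
  have : G \subset 'C_G[x] :&: 'C_G[y] by rewrite -eG.
  rewrite subsetI => /andP[sGx sGy].
  have Zx : x \in 'Z(G) by rewrite mem_center_subcent1 // eqEsubset subsetIl.
  have Zy : y \in 'Z(G) by rewrite mem_center_subcent1 // eqEsubset subsetIl.
  exists (x * y^-1); first by rewrite groupM ?groupV.
  by rewrite -eq_mulgV1.
have Gz : z \in G by case/setIP: Zz.
exists z 1; rewrite ?inE ?Gz ?group1 //.
rewrite subcent_pair cent11T setIT; apply/esym/setIidPr.
by move: Zz; rewrite mem_center_subcent1 // => /eqP->.
Qed.

(** Only an inequality, since the trivial group has no pair of distinct elements. *)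
Lemma two_cent_abelian {gT : finGroupType} {G : {group gT}} :
  abelian G -> #|two_cent G| <= 1.
Proof.
move=> abG; rewrite -(cards1 (G : {set gT})) subset_leq_card //.
apply/subsetP=> _ /imset2P[x y Gx /setIdP[Gy _] ->]; rewrite inE; apply/eqP.
by apply/setIidPl; rewrite centsC (subset_trans _ abG) // subUset !sub1set Gx.
Qed.

(* If every proper 2-centralizer were a centralizer, a centralizer of least
   order would lie in all the others, hence would be central. *)
Lemma two_cent_extra {gT : finGroupType} {G : {group gT}} : ~~ abelian G ->
  exists2 D, D \in two_cent G & D \notin (G : {set gT}) |: proper_cents G.
Proof.
move=> nabG.
have [x0 nZx0] : exists x, x \in G :\: 'Z(G).
  have /subsetPn[x Gx nZx] : ~~ (G \subset 'Z(G)).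
    by apply: contra nabG => sGZ; rewrite (abelianS sGZ) ?center_abelian.
  by exists x; rewrite inE nZx.
case: (arg_minnP (fun x => #|'C_G[x]|) nZx0) => x /setDP[Gx nZx] minx.
apply/exists_inP/contraT; rewrite negb_exists_in => /forall_inP clos.
suff : x \in 'Z(G) by rewrite (negPf nZx).
rewrite inE Gx; apply/centP=> y Gy; apply/cent1P.
have [->|neqxy] := eqVneq x y; first exact: cent1id.
have: 'C_G([set x; y]) \in two_cent G.
  by apply/imset2P; exists x y; rewrite ?inE ?Gy.
move/clos; rewrite negbK subcent_pair in_setU1 => /orP[/eqP eG|].
  have := subsetIl 'C_G[x] 'C_G[y]; rewrite eG => sGx.
  by case/negP: nZx; rewrite mem_center_subcent1 // eqEsubset subsetIl.
case/proper_centsP=> z [Gz nZz eC].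
have : 'C_G[x] :&: 'C_G[y] == 'C_G[x].
  by rewrite eqEcard subsetIl eC minx //; apply/setDP.
move/eqP/setIidPl/subsetP/(_ _ (mem_subcent1 Gx)).
by case/setIP.
Qed.

Lemma card_proper_cents_lt {gT : finGroupType} {G : {group gT}} : ~~ abelian G ->
  #|proper_cents G| + ('Z(G) != 1) < #|two_cent G|.
Proof.
move=> nabG; have [D D2 nD] := two_cent_extra nabG.
move: nD; rewrite !inE negb_or => /andP[nDG nDc].
have [Z1|nZ1] := boolP ('Z(G) != 1).
  rewrite addn1 -[_.+2]/(1 + (1 + _))%N.
  have <- : #|D |: ((G : {set gT}) |: proper_cents G)| = (1 + (1 + #|proper_cents G|))%N.
    by rewrite !cardsU1 !inE negb_or nDG nDc group_notin_proper_cents.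
  by rewrite subset_leq_card // !subUset !sub1set D2 group_in_two_cent Z1 proper_cents_sub_two_cent.
rewrite addn0.
have <- : #|D |: proper_cents G| = (#|proper_cents G|).+1 by rewrite cardsU1 nDc.
by rewrite subset_leq_card // subUset sub1set D2 proper_cents_sub_two_cent.
Qed.

(** * Groups whose proper centralizers are abelian *)

(** An abelian centralizer is contained in the centralizer of each of its elements; [x] and [y] lie
    in each other's centralizers, which gives both inclusions. *)
Lemma centralizer_abelian_eq {gT : finGroupType} {G : {group gT}} {x y : gT} :
    centralizer_abelian G -> x \in G -> x \notin 'Z(G) ->
  y \in 'C_G[x] -> y \notin 'Z(G) -> 'C_G[y] = 'C_G[x].
Proof.
move=> caG Gx nZx Cxy nZy; have Gy : y \in G by case/setIP: Cxy.
have sub u v : u \in G -> u \notin 'Z(G) -> v \in 'C_G[u] -> 'C_G[u] \subset 'C_G[v].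
  move=> Gu nZu Cuv; rewrite subsetI subsetIl sub_cent1.
  by apply: (subsetP (caG u _)) => //; rewrite inE nZu.
apply/eqP; rewrite eqEsubset !sub //.
by rewrite inE Gx cent1C; case/setIP: Cxy.
Qed.

(** A noncentral [g] in both [A] and [B] would make each of them equal to ['C_G[g]]. *)
Lemma centralizer_abelian_cap {gT : finGroupType} {G : {group gT}} {A B : {set gT}} :
    centralizer_abelian G -> A \in proper_cents G -> B \in proper_cents G ->
  A != B -> A :&: B = 'Z(G).
Proof.
move=> caG /proper_centsP[x [Gx nZx ->]] /proper_centsP[y [Gy nZy ->]] neqC.
apply/eqP; rewrite eqEsubset subsetI !center_sub_subcent1 // !andbT.
apply/subsetP=> g /setIP[Cxg Cyg]; apply: contraNT neqC => nZg.
by rewrite -(centralizer_abelian_eq caG Gx nZx Cxg nZg)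
           -(centralizer_abelian_eq caG Gy nZy Cyg nZg).
Qed.

(** The term [.+1] accounts for ['Z(G)]: two proper centralizers are equal or meet in the center.
    This bounds the count above, and [card_proper_cents_lt] bounds it below. *)
Lemma card_two_cent {gT : finGroupType} {G : {group gT}} :
    ~~ abelian G -> centralizer_abelian G ->
  #|two_cent G| = (#|proper_cents G|.+1 + ('Z(G) != 1%g))%N.
Proof.
move=> nabG caG.
apply/eqP; rewrite eqn_leq; apply/andP; split; last first.
  by rewrite addSn card_proper_cents_lt.
have sub : two_cent G \subset
    (if 'Z(G) != 1 then [set (G : {set gT})] else set0) :|: ('Z(G) |: proper_cents G).
  apply/subsetP=> D D2; rewrite in_setU.
  have [eDG|nDG] := eqVneq D G.
    by rewrite eDG in D2 *; rewrite -group_in_two_cent D2 set11.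
  apply/orP; right; rewrite in_setU1.
  case/imset2P: D2 nDG => x y Gx /setIdP[Gy _] ->; rewrite subcent_pair.
  have sCG u : 'C_G[u] \subset G by apply: subsetIl.
  have CE u : u \in G -> u \notin 'Z(G) -> 'C_G[u] \in proper_cents G.
    by move=> Gu nZu; apply/proper_centsP; exists u.
  have [Zx|nZx] := boolP (x \in 'Z(G)).
    move: Zx; rewrite mem_center_subcent1 // => /eqP->; rewrite (setIidPr (sCG y)).
    by rewrite -mem_center_subcent1 // => nZy; rewrite CE ?orbT.
  move=> _; have [Zy|nZy] := boolP (y \in 'Z(G)).
    move: Zy; rewrite mem_center_subcent1 // => /eqP->; rewrite (setIidPl (sCG x)).
    by rewrite CE ?orbT.
  have [<-|neqC] := eqVneq 'C_G[x] 'C_G[y]; first by rewrite setIid CE ?orbT.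
  by rewrite (centralizer_abelian_cap caG _ _ neqC) ?CE // eqxx.
apply: leq_trans (subset_leq_card sub) _.
apply: leq_trans (leq_card_setU _ _) _; rewrite addnC leq_add //.
  by rewrite cardsU1 center_notin_proper_cents.
by case: ifP; rewrite ?cards1 ?cards0.
Qed.

(* If a, b in C(x) do not commute and g is not in C(x), the centralizers of
   x, a, b, ab, g, gx are pairwise distinct. *)
Lemma centralizer_abelian_small {gT : finGroupType} {G : {group gT}} :
  #|proper_cents G| <= 5 -> centralizer_abelian G.
Proof.
move=> le5 x /setDP[Gx nZx]; apply: contraLR le5 => nab; rewrite -ltnNge.
have /subsetPn[a Ca nca] : ~~ ('C_G[x] \subset 'C('C_G[x])) by [].
have /subsetPn[b Cb] : ~~ ('C_G[x] \subset 'C[a]) by rewrite sub_cent1.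
have /subsetPn[g Gg] : ~~ (G \subset 'C[x]) by move: nZx; rewrite inE Gx sub_cent1.
case/setIP: Ca => Ga xa; case/setIP: Cb => Gb xb xg ab.
have memE u v w : w \in G -> 'C_G[u] = 'C_G[v] -> (w \in 'C[u]) = (w \in 'C[v]).
  by move=> Gw /setP/(_ w); rewrite !inE Gw.
have ba : a \notin 'C[b] by rewrite cent1C.
have nC u v : u \in G -> v \notin 'C[u] -> v \in G -> 'C_G[u] \in proper_cents G.
  move=> Gu Cuv Gv; apply/proper_centsP; exists u; split=> //.
  by apply: contra Cuv => /setIP[_ /centP/(_ v Gv)] /esym/cent1P.
have gx : x \notin 'C[g] by rewrite cent1C.
have gxx : x \notin 'C[g * x].
  by rewrite cent1C groupMr ?cent1id.
have ggx : g \notin 'C[g * x].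
  by rewrite cent1C groupMl ?cent1id.
have a_ab : a * b \notin 'C[a] by rewrite groupMl ?cent1id.
have b_ab : a * b \notin 'C[b] by rewrite groupMr ?cent1id.
pose s := [:: 'C_G[x]; 'C_G[a]; 'C_G[b]; 'C_G[a * b]; 'C_G[g]; 'C_G[g * x]].
have us : uniq s.
  (* In each use below, [w] is an element commuting with exactly one of [u] and [v]. *)
  have neq u v w : w \in G -> (w \in 'C[u]) != (w \in 'C[v]) -> 'C_G[u] == 'C_G[v] = false.
    by move=> Gw; apply: contraNF => /eqP/(memE _ _ _ Gw)->.
  have xab : a * b \in 'C[x] by rewrite groupM.
  rewrite /s /= !inE !negb_or !andbT.
  rewrite (neq x a b) ?xb ?(negPf ab) // (neq x b a) ?xa ?(negPf ba) //.
  rewrite (neq x (a * b) a) ?xa //; last by rewrite cent1C (negPf a_ab).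
  rewrite (neq x g x) ?cent1id ?(negPf gx) // (neq x (g * x) x) ?cent1id ?(negPf gxx) //.
  rewrite (neq a b a) ?cent1id ?(negPf ba) //.
  rewrite (neq a (a * b) a) ?cent1id //; last by rewrite cent1C (negPf a_ab).
  rewrite (neq a g x) ?(negPf gx) //; last by rewrite cent1C xa.
  rewrite (neq a (g * x) x) ?(negPf gxx) //; last by rewrite cent1C xa.
  rewrite (neq b (a * b) b) ?cent1id //; last by rewrite cent1C (negPf b_ab).
  rewrite (neq b g x) ?(negPf gx) //; last by rewrite cent1C xb.
  rewrite (neq b (g * x) x) ?(negPf gxx) //; last by rewrite cent1C xb.
  rewrite (neq (a * b) g x) ?(negPf gx) //; last by rewrite cent1C xab.
  rewrite (neq (a * b) (g * x) x) ?(negPf gxx) //; last by rewrite cent1C xab.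
  by rewrite (neq g (g * x) g) ?cent1id ?(negPf ggx).
rewrite -[6]/(size s); move/card_uniqP: (us) => <-.
apply/subset_leq_card/subsetP/allP; rewrite /s /= andbT.
rewrite (nC _ _ Gx xg) // (nC _ _ Ga ab) // (nC _ _ Gb ba) // (nC _ _ Gg gx) //.
rewrite (nC _ _ (groupM Ga Gb) (_ : a \notin _)) ?(nC _ _ (groupM Gg Gx) gxx) //.
by rewrite cent1C.
Qed.

(** * Arithmetic of the indices of the center *)

Definition card_index_eq {gT : finGroupType} (G : {group gT}) (m : nat) : nat :=
  #|[set A in proper_cents G | #|A : 'Z(G)| == m]|.

Lemma proper_cent_card {gT : finGroupType} {G : {group gT}} {A : {set gT}} :
  A \in proper_cents G -> #|A| = (#|'Z(G)| * #|A : 'Z(G)|)%N.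
Proof.
by case/proper_centsP=> x [Gx _ ->]; rewrite Lagrange ?center_sub_subcent1.
Qed.

Lemma proper_cent_index_gt1 {gT : finGroupType} {G : {group gT}} {A : {set gT}} :
  A \in proper_cents G -> 1 < #|A : 'Z(G)|.
Proof.
case/proper_centsP=> x [Gx nZx ->]; rewrite indexg_gt1.
by apply: contra nZx => /subsetP->; rewrite ?mem_subcent1.
Qed.

Lemma proper_cent_index_dvd {gT : finGroupType} {G : {group gT}} {A : {set gT}} :
  A \in proper_cents G -> #|A : 'Z(G)| %| #|G : 'Z(G)|.
Proof.
case/proper_centsP=> x [Gx nZx ->].
rewrite -(dvdn_pmul2l (cardG_gt0 'Z(G))) !Lagrange ?center_sub_subcent1 ?center_sub //.
by rewrite cardSg ?subsetIl.
Qed.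

Lemma proper_cent_index_lt {gT : finGroupType} {G : {group gT}} {A : {set gT}} :
  A \in proper_cents G -> #|A : 'Z(G)| < #|G : 'Z(G)|.
Proof.
move=> cA; rewrite -(ltn_pmul2l (cardG_gt0 'Z(G))) -(proper_cent_card cA).
rewrite Lagrange ?center_sub //.
case/proper_centsP: cA => x [Gx nZx ->]; rewrite proper_card // properEneq subsetIl andbT.
by rewrite -mem_center_subcent1.
Qed.

(** Lift an element of order [p] of [G / 'Z(G)] to [x]; its image lies in the quotient of
    ['C_G[x]]. *)
Lemma cauchy_proper_cent {gT : finGroupType} {G : {group gT}} {p : nat} :
    prime p -> p %| #|G : 'Z(G)| ->
  exists2 A, A \in proper_cents G & p %| #|A : 'Z(G)|.
Proof.
move=> p_pr; rewrite -card_quotient ?gFnorm // => /(Cauchy p_pr)[xb Gxb oxb].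
case/morphimP: Gxb oxb => x Nx Gx -> oxb.
have nZx : x \notin 'Z(G).
  by apply: contraTN p_pr => Zx; rewrite -oxb /= coset_id // order1.
exists 'C_G[x]; first by apply/proper_centsP; exists x.
rewrite -card_quotient ?(subset_trans (subsetIl _ _)) ?gFnorm // -oxb.
by rewrite order_dvdG // mem_quotient ?mem_subcent1.
Qed.

(** The fibre over [A] of the map sending a noncentral [x] to ['C_G[x]] is [A :\: 'Z(G)]. Counting
    noncentral elements by fibres gives the equation multiplied by [#|'Z(G)|]. *)
Lemma sum_index_proper_cents {gT : finGroupType} {G : {group gT}} :
    centralizer_abelian G ->
  \sum_(A in proper_cents G) #|A : 'Z(G)|.-1 = #|G : 'Z(G)|.-1.
Proof.
move=> caG; have Z_gt0 := cardG_gt0 'Z(G).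
have idxE A : (#|'Z(G)| * #|A : 'Z(G)|.-1)%N = (#|'Z(G)| * #|A : 'Z(G)| - #|'Z(G)|)%N.
  by rewrite -subn1 mulnBr muln1.
apply/eqP; rewrite -(eqn_pmul2l Z_gt0) big_distrr /= idxE Lagrange ?center_sub //.
rewrite -cardsDS ?center_sub // -sum1_card.
rewrite (partition_big_imset (fun x => 'C_G[x])) /=; apply/eqP/eq_bigr => A cA.
rewrite idxE -(proper_cent_card cA) sum1dep_card.
case/proper_centsP: cA => x [Gx nZx ->]; rewrite -cardsDS ?center_sub_subcent1 //.
apply: eq_card => y; apply/setDP/setIdP => [[Cxy nZy] | [/setDP[Gy nZy] /eqP<-]].
  by rewrite (centralizer_abelian_eq caG Gx nZx Cxy nZy) inE nZy eqxx; case/setIP: Cxy.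
by rewrite mem_subcent1.
Qed.

(** Since [A] and [B] meet in the center, their product has order [#|A| #|B| / #|'Z(G)|], and it
    lies in [G]. *)
Lemma mul_index_proper_cents {gT : finGroupType} {G : {group gT}} {A B : {set gT}} :
    centralizer_abelian G -> A \in proper_cents G -> B \in proper_cents G -> A != B ->
  #|A : 'Z(G)| * #|B : 'Z(G)| <= #|G : 'Z(G)|.
Proof.
move=> caG cA cB neqAB; have Z_gt0 := cardG_gt0 'Z(G).
have capZ := centralizer_abelian_cap caG cA cB neqAB.
rewrite -(leq_pmul2l Z_gt0) -(leq_pmul2r Z_gt0) (Lagrange (center_sub G)).
rewrite mulnA -(proper_cent_card cA) -mulnA [(_ * #|'Z(G)|)%N]mulnC -(proper_cent_card cB).
case/proper_centsP: cA capZ => x [Gx _ ->]; case/proper_centsP: cB => y [Gy _ ->] capZ.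
by rewrite (mul_cardG 'C_G[x]) capZ leq_mul2r subset_leq_card ?orbT // mul_subG ?subsetIl.
Qed.

(** Let [M] have the largest index b, and let n be the index in [G]. Every other index c satisfies b
    (c - 1) <= n - b. Summing over these k - 1 centralizers gives b (n - b) <= (k - 1) (n - b), and
    n > b. *)
Lemma proper_cent_index_bound {gT : finGroupType} {G : {group gT}} {A : {set gT}} :
    centralizer_abelian G -> A \in proper_cents G ->
  #|A : 'Z(G)| < #|proper_cents G|.
Proof.
move=> caG cA; case: (arg_maxnP (fun B : {set gT} => #|B : 'Z(G)|) cA) => M cM maxM.
apply: leq_ltn_trans (maxM _ cA) _ => {A cA maxM}.
have {}cM : M \in proper_cents G by [].
have b_lt := proper_cent_index_lt cM.
have := sum_index_proper_cents caG; rewrite (bigD1 M) //= => sumE.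
have {}sumE : \sum_(A in proper_cents G | A != M) #|A : 'Z(G)|.-1
           = (#|G : 'Z(G)| - #|M : 'Z(G)|)%N.
  by have := proper_cent_index_gt1 cM; move: sumE b_lt; set s := \sum_(_ | _) _; lia.
have: #|M : 'Z(G)| * (#|G : 'Z(G)| - #|M : 'Z(G)|)
      <= #|proper_cents G :\ M| * (#|G : 'Z(G)| - #|M : 'Z(G)|).
  rewrite -sumE big_distrr /= sumE -sum_nat_const [leqLHS](eq_bigl (fun A => A \in proper_cents G :\ M)).
    apply: leq_sum => A /setD1P[neqAM cA].
    rewrite -subn1 mulnBr muln1 leq_sub2r // (mul_index_proper_cents caG) //.
    by rewrite eq_sym.
  by move=> A; rewrite !inE andbC.
by rewrite leq_pmul2r ?subn_gt0 // (cardsD1 M (proper_cents G)) cM.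
Qed.

(** Only the indices 2, 3 and 4 occur; in [sum_index_proper_cents] a centralizer of index m has
    weight m - 1. *)
Lemma index_proper_cents_count {gT : finGroupType} {G : {group gT}} :
    centralizer_abelian G ->
    {in proper_cents G, forall A : {set gT}, #|A : 'Z(G)| <= 4} ->
  #|proper_cents G| = (card_index_eq G 2 + card_index_eq G 3 + card_index_eq G 4)%N /\
  #|G : 'Z(G)| =
    (1 + card_index_eq G 2 + 2 * card_index_eq G 3 + 3 * card_index_eq G 4)%N.
Proof.
move=> caG le4.
have cntE m : card_index_eq G m = \sum_(A in proper_cents G) (#|A : 'Z(G)| == m).
  by rewrite /card_index_eq -sum1dep_card big_mkcondr.
have idx A : A \in proper_cents G -> [\/ #|A : 'Z(G)| = 2, #|A : 'Z(G)| = 3 | #|A : 'Z(G)| = 4].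
  move=> cA; have := proper_cent_index_gt1 cA; have := le4 A cA.
  case: (#|A : 'Z(G)|) => [|[|[|[|[|n]]]]] // _ _.
  - exact: Or31.
  - exact: Or32.
  - exact: Or33.
split.
  rewrite !cntE -!big_split -sum1_card /=; apply: eq_bigr => A cA.
  by case: (idx A cA) => ->.
rewrite -(prednK (indexg_gt0 G 'Z(G))) -(sum_index_proper_cents caG).
rewrite !cntE !big_distrr -!addnA -!big_split /= add1n; congr _.+1; apply: eq_bigr => A cA.
by case: (idx A cA) => ->.
Qed.

Lemma card_index_eq_gt0 {gT : finGroupType} {G : {group gT}} {m : nat} :
  0 < card_index_eq G m -> m %| #|G : 'Z(G)|.
Proof.
by rewrite card_gt0 => /set0Pn[A /setIdP[cA /eqP<-]]; apply: proper_cent_index_dvd.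
Qed.

Lemma card_index_eq_gt1 {gT : finGroupType} {G : {group gT}} {m : nat} :
  centralizer_abelian G -> 1 < card_index_eq G m -> m ^ 2 <= #|G : 'Z(G)|.
Proof.
move=> caG /card_gt1P[A [B [/setIdP[cA /eqP eA] /setIdP[cB /eqP eB] neqAB]]].
by rewrite expnS expn1 -{1}eA -eB mul_index_proper_cents.
Qed.

(** * The cases of four and of five proper centralizers *)

(** Among the groups of order 12 this singles out A_4, by [isog_Alt4] and [isog_Alt4_inv]. *)
Definition no_normal_card3 {gT : finGroupType} (G : {group gT}) : Prop :=
  forall Q : {group gT}, Q <| G -> #|Q| <> 3.

(** All indices are 2 or 3. If c of them are 3, then n = 5 + c, and divisibility of n by the indices
    that occur leaves c = 1 or c = 4. *)
Lemma index_center_four {gT : finGroupType} {G : {group gT}} :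
    centralizer_abelian G -> #|proper_cents G| = 4 ->
  #|G : 'Z(G)| = 6 \/ #|G : 'Z(G)| = 9.
Proof.
move=> caG k4.
have le3 A : A \in proper_cents G -> #|A : 'Z(G)| < 4.
  by move=> cA; rewrite -k4 proper_cent_index_bound.
have c40 : card_index_eq G 4 = 0.
  apply/eqP; rewrite cards_eq0 -subset0; apply/subsetP=> A /setIdP[/le3 lt4 /eqP eA].
  by rewrite eA in lt4.
have [|] := index_proper_cents_count caG; first by move=> A /le3/ltnW.
have := @card_index_eq_gt0 _ G 2; have := @card_index_eq_gt0 _ G 3.
by rewrite k4 c40; lia.
Qed.

Lemma card_center1_five {gT : finGroupType} {G : {group gT}} :
    centralizer_abelian G -> #|proper_cents G| = 5 -> 'Z(G) = 1 ->
  #|G| = 12 /\ no_normal_card3 G.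
Proof.
move=> caG k5 Z1.
have iG : #|G : 'Z(G)| = #|G| by rewrite Z1 indexg1.
(* A 2-group with trivial center is trivial. This removes the orders 8 and 16, which satisfy the
   counting conditions. *)
have n2 : ~~ 2.-group G.
  apply: contraTN isT => p2; have G1 := trivg_center_pgroup p2 Z1.
  have := k5; rewrite /proper_cents Z1 G1 setDv imset0 cards0.
  by [].
have n8 : #|G| <> 8 by move=> e; case/negP: n2; rewrite /pgroup e.
have n16 : #|G| <> 16 by move=> e; case/negP: n2; rewrite /pgroup e.
have le4 : {in proper_cents G, forall A : {set gT}, #|A : 'Z(G)| <= 4}.
  by move=> A cA; rewrite -ltnS -k5 proper_cent_index_bound.
(* This removes order 6 with five centralizers of order 2. *)
have cau3 : 3 %| #|G| -> 0 < card_index_eq G 3.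
  rewrite -iG => /(cauchy_proper_cent (isT : prime 3))[A cA d3].
  rewrite card_gt0; apply/set0Pn; exists A; rewrite inE cA /=.
  have := le4 A cA; have := proper_cent_index_gt1 cA; move: d3; lia.
have [] := index_proper_cents_count caG le4.
have := @card_index_eq_gt0 _ G 2; have := @card_index_eq_gt0 _ G 3.
have := @card_index_eq_gt0 _ G 4; have : 1 < card_index_eq G 4 -> 16 <= #|G : 'Z(G)| := card_index_eq_gt1 caG.
rewrite iG k5 => h4' h4 h3 h2 hk hn.
(* Writing c_m for [card_index_eq G m], the order is 6 + c_3 + 2 c_4, at most 16. Two centralizers
   of order 4 would force order 16, so c_4 <= 1; the solution left is c_3 = 4, c_4 = 1. *)
have [oG c3] : #|G| = 12 /\ card_index_eq G 3 = 4.
  by move: hk hn h2 h3 h4 h4' cau3 n8 n16; clear; lia.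
split=> // Q nQ oQ.
(* A normal Sylow subgroup [Q] would contain, hence equal, all four centralizers of order 3. *)
have sQ : 3.-Sylow(G) Q.
  by rewrite pHallE normal_sub //= oG oQ p_part.
have : 1 < card_index_eq G 3 by rewrite c3.
case/card_gt1P=> A [B [/setIdP[cA eA] /setIdP[cB eB] neqAB]].
case/negP: neqAB.
have eQ C : C \in proper_cents G -> #|C : 'Z(G)| == 3 -> C = Q.
  move=> cC; have := proper_cent_card cC; rewrite {1}Z1 cards1 mul1n => oC.
  rewrite -oC => /eqP {}oC.
  case/proper_centsP: cC oC => x [Gx _ ->] oC.
  apply/eqP; rewrite eqEcard oC oQ leqnn andbT.
  by rewrite (sub_normal_Hall sQ) ?subsetIl // /pgroup oC.
by apply/eqP; apply: etrans (eQ A cA eA) (esym (eQ B cB eB)).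
Qed.

(** * Recognition of A_4 *)

Lemma card_Alt4 : #|'Alt_('I_4)| = 12.
Proof.
by have := @card_Alt 'I_4; rewrite card_ord => /(_ isT); rewrite -[4`!]/24; lia.
Qed.

Lemma isog_Alt4 {gT : finGroupType} {G : {group gT}} :
  #|G| = 12 -> no_normal_card3 G -> G \isog 'Alt_('I_4).
Proof.
move=> oG nn3; have [P sylP] := Sylow_exists 3 G.
have sPG := pHall_sub sylP.
have oP : #|P| = 3 by rewrite (card_Hall sylP) oG p_part.
have core1 : gcore P G = 1.
  apply/trivgP/negbNE/negP=> nt; apply: (nn3 (gcore_group P G)).
    exact: gcore_normal.
  apply/prime_nt_dvdP => //; first by rewrite -trivg_card1 -subG1.
  by rewrite -oP cardSg // gcore_sub.
have iP : #|G : P| = 4 by rewrite -divgS // oG oP.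
have [f injf] := coset_perm_rep G P 4 sPG core1 iP.
(* It remains to see that all images are even: the parity kernel [K] has index at most 2 and must be
   [G]. *)
have hM : {in G &, {morph (fun x => odd_perm (f x)) : x y / x * y}}.
  by move=> x y Gx Gy; rewrite morphM // odd_permM.
pose h := Morphism hM; pose K := ('ker h)%G.
have nKG : K <| G := ker_normal h.
have iK : #|G : K| <= 2.
  by rewrite -[in X in #|X : _|](setIid G) -card_morphim -card_bool max_card.
(* Otherwise [P] and [K] meet trivially, so 3 [#|K|] <= 12 and [K] has index at least 3. *)
have sPK : P \subset K.
  apply: contraLR iK => nPK; rewrite -ltnNge.
  have tiPK : P :&: K = 1 by rewrite prime_TIg // oP.
  have := mul_cardG P K; rewrite tiPK cards1 muln1 oP => oPK.
  have : #|P * K| <= 12 by rewrite -oG; apply: subset_leq_card (mul_subG sPG (normal_sub nKG)).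
  rewrite -oPK => leK; have := Lagrange (normal_sub nKG); rewrite oG; nia.
(* If the index were 2, [P] would have index 2 in [K], hence be the 3-core of [K] and normal in
   [G]. *)
have iK1 : #|G : K| = 1%N.
  have := indexg_gt0 G K; have := Lagrange (normal_sub nKG); rewrite oG.
  case: #|G : K| iK (erefl #|G : K|) => [|[|[|//]]] // _ iK oK _.
  have {}oK : #|K| = 6 by lia.
  have nPK : P <| K by rewrite index2_normal // -divgS // oK oP.
  have sylPK : 3.-Sylow(K) P by rewrite pHallE sPK oK oP p_part.
  case: (nn3 P) => //; rewrite -(normal_Hall_pcore sylPK nPK).
  exact: gFnormal_trans.
have sGK : G \subset K by rewrite -indexg_eq1 iK1.
have fG : f @* G = 'Alt_('I_4).
  apply/eqP; rewrite eqEcard card_Alt4 (card_injm injf) // oG leqnn andbT.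
  apply/subsetP=> _ /morphimP[x _ Gx ->]; rewrite Alt_even.
  by have /mker /= -> := subsetP sGK x Gx.
by rewrite -fG sub_isog.
Qed.

(** A_4 is 2-transitive, hence primitive, so a nontrivial normal subgroup is transitive and its
    order is divisible by 4. *)
Lemma isog_Alt4_inv {gT : finGroupType} {G : {group gT}} :
  G \isog 'Alt_('I_4) -> #|G| = 12 /\ no_normal_card3 G.
Proof.
move=> isoG.
split=> [|Q nQ oQ]; first by rewrite (card_isog isoG) card_Alt4.
case/isogP: isoG => f injf fG.
have nfQ : f @* Q <| 'Alt_('I_4) by rewrite -fG morphim_normal.
have ofQ : #|f @* Q| = 3 by rewrite card_injm // normal_sub.
have tr2 : [transitive^2 'Alt_('I_4), on setT | 'P].
  by have := Alt_trans 'I_4; rewrite card_ord.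
have [sC|tr] := prim_trans_norm (ntransitive_primitive (isT : 1 < 2) tr2) nfQ.
  have := subset_leq_card (subset_trans sC (aperm_faithful _)).
  by rewrite ofQ cards1.
by have := atrans_dvd tr; rewrite ofQ cardsT card_ord.
Qed.

(** * Counting 2-centralizers in the listed groups *)

(** A group that is cyclic modulo a central subgroup is abelian. *)
Lemma centralizer_abelian_prime_index {gT : finGroupType} {G : {group gT}} :
    {in proper_cents G, forall A : {set gT}, prime #|A : 'Z(G)|} ->
  centralizer_abelian G.
Proof.
move=> prG x /setDP[Gx nZx].
have cC : 'C_G[x] \in proper_cents G by apply/proper_centsP; exists x.
have sZC := center_sub_subcent1 Gx.
apply: (@cyclic_factor_abelian _ 'Z(G)).
  by rewrite subsetI sZC (subset_trans (subsetIr _ _)) // centS ?subsetIl.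
apply: prime_cyclic; rewrite card_quotient ?prG //.
by rewrite (subset_trans (subsetIl _ _)) ?gFnorm.
Qed.

(** The indices are proper divisors of 6 or 9, hence prime. For n = 6, Cauchy and 9 > 6 give exactly
    one index 3 and three indices 2; for n = 9 there are four indices 3. *)
Lemma two_cent_index_6_9 {gT : finGroupType} {G : {group gT}} :
  'Z(G) != 1 -> #|G : 'Z(G)| = 6 \/ #|G : 'Z(G)| = 9 -> #|two_cent G| = 6.
Proof.
move=> nZ1 iG.
have nabG : ~~ abelian G.
  by apply/negP=> abG; move: iG; rewrite (center_idP abG) indexgg => -[].
have idx A : A \in proper_cents G ->
    #|A : 'Z(G)| = 3 \/ #|A : 'Z(G)| = 2 /\ #|G : 'Z(G)| = 6.
  move=> cA; have := proper_cent_index_gt1 cA; have := proper_cent_index_lt cA.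
  by have := proper_cent_index_dvd cA; case: iG => ->;
    case: #|A : 'Z(G)| => [|[|[|[|[|[|[|[|[|n]]]]]]]]] //; auto.
have caG : centralizer_abelian G.
  by apply: centralizer_abelian_prime_index => A /idx[|[]] ->.
suff k4 : #|proper_cents G| = 4 by rewrite card_two_cent // k4 nZ1.
have le4 : {in proper_cents G, forall A : {set gT}, #|A : 'Z(G)| <= 4}.
  by move=> A /idx[|[]] ->.
have cau3 : 0 < card_index_eq G 3.
  have [|A cA d3] := @cauchy_proper_cent _ G 3 isT; first by case: iG => ->.
  rewrite card_gt0; apply/set0Pn; exists A; rewrite inE cA /=.
  by case: (idx A cA) => [->|[e]] //; rewrite e in d3.
have c40 : card_index_eq G 4 = 0.
  apply/eqP; rewrite cards_eq0 -subset0; apply/subsetP=> A /setIdP[/idx cA /eqP eA].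
  by rewrite eA in cA; case: cA => [|[]].
have := @card_index_eq_gt0 _ G 2.
have : 1 < card_index_eq G 3 -> 9 <= #|G : 'Z(G)| := card_index_eq_gt1 caG.
have [-> ] := index_proper_cents_count caG le4.
rewrite c40; move: cau3 iG; clear; lia.
Qed.

(** The number of Sylow 3-subgroups is not 1, divides 12 and is 1 modulo 3, so it is 4. Thus [<[x]>]
    is its own normalizer in [G]. *)
Lemma subcent1_card12 {gT : finGroupType} {G : {group gT}} {x : gT} :
    #|G| = 12 -> no_normal_card3 G -> x \in G -> #[x] = 3 -> 'C_G[x] = <[x]>.
Proof.
move=> oG nn3 Gx ox; have sxG : <[x]> \subset G by rewrite cycle_subG.
have sylx : 3.-Sylow(G) <[x]>.
  by rewrite pHallE sxG -[#|<[x]>|]/#[x] ox oG p_part.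
have iN : #|G : 'N_G(<[x]>)| = 4.
  have := card_Syl_mod G (isT : prime 3); have := card_Syl_dvd 3 G.
  have ni1 : #|G : 'N_G(<[x]>)| <> 1%N.
    move/eqP; rewrite indexg_eq1 subsetI subxx /= => nxG.
    by apply: (nn3 <[x]>%G) => //; apply/andP.
  rewrite (card_Syl sylx) oG; move: #|_ : _| ni1 => m m1 m12 mod3.
  have := dvdn_leq (isT : 0 < 12) m12; move: m1 m12 mod3.
  by do 13?[case: m => [|m] //].
have oN : #|'N_G(<[x]>)| = 3.
  by apply/eqP; rewrite -(eqn_pmul2r (isT : 0 < 4)) -{1}iN Lagrange ?subsetIl ?oG.
apply/esym/eqP; rewrite eqEcard subsetI sxG cycle_subG cent1id /=.
rewrite -[#|<[x]>|]/#[x] ox -oN subset_leq_card // setIS //.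
by rewrite (subset_trans _ (cent_sub _)) // cent_cycle.
Qed.

Lemma center1_card12 {gT : finGroupType} {G : {group gT}} :
  #|G| = 12 -> no_normal_card3 G -> 'Z(G) = 1.
Proof.
move=> oG nn3.
have [x0 Gx0 ox0] : {x | x \in G & #[x] = 3} by apply: Cauchy; rewrite ?oG.
have sZ := center_sub_subcent1 Gx0; rewrite (subcent1_card12 oG nn3 Gx0 ox0) in sZ.
apply/trivgP/negbNE/negP=> nt; apply: (nn3 'Z(G)%G); first exact: center_normal.
by apply/prime_nt_dvdP; rewrite // -?trivg_card1 -?subG1 // -ox0 cardSg.
Qed.

Lemma two_cent_card12 {gT : finGroupType} {G : {group gT}} :
  #|G| = 12 -> no_normal_card3 G -> #|two_cent G| = 6.
Proof.
move=> oG nn3.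
have nabG : ~~ abelian G.
  have [Q sylQ] := Sylow_exists 3 G.
  apply/negP=> abG; apply: (nn3 Q); last by rewrite (card_Hall sylQ) oG p_part.
  by rewrite -(sub_abelian_normal _ abG) (pHall_sub sylQ).
have Z1 := center1_card12 oG nn3.
have cardC x : x \in G -> x \notin 'Z(G) -> #|'C_G[x]| = 3 \/ #|'C_G[x]| = 4.
  move=> Gx; rewrite Z1 inE => nx1.
  (* An element [y] of order 3 commuting with [x] has centralizer [<[y]>], so [x] generates it too.
     Otherwise ['C_G[x]] is a 2-group inside a Sylow subgroup of order 4, which is abelian and so
     centralizes [x]. *)
  have [/(Cauchy (isT : prime 3))[y Cy oy] | n3] := boolP (3 %| #|'C_G[x]|).
    left; have [Gy Cxy] := setIP Cy.
    have : x \in <[y]> by rewrite -(subcent1_card12 oG nn3 Gy oy) inE Gx cent1C.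
    move=> yx; have ox : #[x] = 3.
      by apply/prime_nt_dvdP; rewrite ?order_eq1 // -oy order_dvdG.
    by rewrite (subcent1_card12 oG nn3 Gx ox).
  right; have d12 : #|'C_G[x]| %| 4.
    have := cardSg (subsetIl G 'C[x]); rewrite oG -[12]/(3 * 4)%N Gauss_dvdr //.
    by rewrite coprime_sym prime_coprime.
  have p2 : 2.-group 'C_G[x] by apply: pnat_dvd d12 _.
  have [S sylS sCS] := Sylow_superset (subsetIl G 'C[x]) p2.
  have oS : #|S| = 4 by rewrite (card_Hall sylS) oG p_part.
  have abS : abelian S by apply: (@card_p2group_abelian _ 2).
  apply/eqP; rewrite eqn_leq dvdn_leq //= -oS subset_leq_card //.
  rewrite subsetI (pHall_sub sylS) sub_cent1 (subsetP abS) //.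
  by rewrite (subsetP sCS) ?mem_subcent1.
have caG : centralizer_abelian G.
  move=> x /setDP[Gx nZx]; have [oC|oC] := cardC x Gx nZx.
    by apply: cyclic_abelian; rewrite prime_cyclic ?oC.
  exact: (@card_p2group_abelian _ 2).
rewrite card_two_cent // Z1 eqxx addn0; congr _.+1.
have idx A : A \in proper_cents G -> #|A : 'Z(G)| = 3 \/ #|A : 'Z(G)| = 4.
  by case/proper_centsP=> x [Gx nZx ->]; rewrite Z1 indexg1; apply: cardC.
have le4 : {in proper_cents G, forall A : {set gT}, #|A : 'Z(G)| <= 4}.
  by move=> A /idx[] ->.
have c20 : card_index_eq G 2 = 0.
  apply/eqP; rewrite cards_eq0 -subset0; apply/subsetP=> A /setIdP[/idx cA /eqP eA].
  by rewrite eA in cA; case: cA.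
(* The equation 11 = 2 c_3 + 3 c_4 also has the solution c_3 = 1, c_4 = 3, which this bound
   excludes. *)
have : 1 < card_index_eq G 4 -> 16 <= #|G : 'Z(G)| := card_index_eq_gt1 caG.
have [] := index_proper_cents_count caG le4.
rewrite c20 Z1 indexg1 oG; lia.
Qed.

(** * Noncyclic groups of orders 9 and 6 *)

(** Both groups are elementary abelian of order 9: an element of order 9 would generate [G]. *)
Lemma isog_Z3xZ3 {gT : finGroupType} {G : {group gT}} :
  #|G| = 9 -> ~~ cyclic G -> G \isog setX (Zp 3) (Zp 3).
Proof.
move=> oG ncG.
have abG : abelian G by apply: (@card_p2group_abelian _ 3).
have eG : 3.-abelem G.
  rewrite abelemE // abG; apply/exponentP=> x Gx; apply/eqP.
  rewrite -order_dvdn; have := order_dvdG Gx; rewrite oG => /(dvdn_pfactor _ 2 (isT : prime 3)).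
  case=> -[|[|[|//]]] _ ox; rewrite ?ox //.
  case/negP: ncG; apply/cyclicP; exists x; apply/eqP.
  by rewrite eq_sym eqEcard cycle_subG Gx oG -[#|<[x]>|]/#[x] ox.
rewrite (isog_abelem_card _ eG) cardsX !card_Zp // oG eqxx andbT abelemE //.
apply/andP; split.
  by apply/centsP=> -[a b] _ [c d] _; congr pair; apply: Zp_mulgC.
apply/exponentP=> -[a b] _; rewrite !expgS expg0.
by apply/eqP; case: a b => [[|[|[|a]]] ?] [[|[|[|b]]] ?].
Qed.

Lemma isog_Sym3 {gT : finGroupType} {G : {group gT}} :
  #|G| = 6 -> ~~ cyclic G -> G \isog 'Sym_('I_3).
Proof.
move=> oG ncG.
have [x Gx ox] : {x | x \in G & #[x] = 2} by apply: Cauchy; rewrite ?oG.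
have [z Gz oz] : {z | z \in G & #[z] = 3} by apply: Cauchy; rewrite ?oG.
have sxG : <[x]> \subset G by rewrite cycle_subG.
have szG : <[z]> \subset G by rewrite cycle_subG.
have ix : #|G : <[x]>| = 3 by rewrite -divgS // oG -[#|<[x]>|]/#[x] ox.
have nzG : <[z]> <| G by rewrite index2_normal // -divgS // oG -[#|<[z]>|]/#[z] oz.
have core1 : gcore <[x]> G = 1.
  (* A nontrivial core makes [<[x]>] normal, like [<[z]>]; the commutator of [x] and [z] then lies
     in both, so they commute and [x * z] generates [G]. *)
  apply/trivgP/negbNE/negP=> nt; case/negP: ncG.
  have ex : gcore <[x]> G = <[x]>.
    apply/eqP; rewrite eqEcard gcore_sub -[#|<[x]>|]/#[x] ox.
    by rewrite ltnNge -trivg_card_le1 -subG1.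
  have nxG : <[x]> <| G by rewrite -ex gcore_normal.
  have tixz : <[x]> :&: <[z]> = 1.
    by rewrite coprime_TIg // -[#|<[x]>|]/#[x] -[#|<[z]>|]/#[z] ox oz.
  have cxz : commute x z.
    apply/commgP; rewrite -in_set1 -[[set 1]]/(1 : {set gT}) -tixz inE.
    have nx : z \in 'N(<[x]>) by apply: subsetP Gz; case/andP: nxG.
    have nz : x \in 'N(<[z]>) by apply: subsetP Gx; case/andP: nzG.
    apply/andP; split; first by rewrite groupMl ?groupV ?cycle_id // memJ_norm ?cycle_id.
    rewrite commgEr groupM ?cycle_id // memJ_norm ?groupV ?cycle_id //.
  apply/cyclicP; exists (x * z); apply/esym/eqP.
  by rewrite eqEcard cycle_subG groupM //= -[#|<[_]>|]/#[_] orderM ?ox ?oz ?oG.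
have [f injf] := coset_perm_rep G <[x]> 3 sxG core1 ix.
have fG : f @* G = 'Sym_('I_3).
  apply/eqP; rewrite eqEcard subsetT card_Sym card_ord (card_injm injf) // oG.
  by [].
by rewrite -fG sub_isog.
Qed.

(** * The classification *)

(** Stated through orders and indices so that it also serves for [G / 'Z(G)] in the primitive
    case. *)
Lemma two_centralizer6_cases {gT : finGroupType} {G : {group gT}} :
    #|two_cent G| = 6 ->
  (#|G| = 12 /\ no_normal_card3 G) \/
  ('Z(G) != 1 /\ (#|G : 'Z(G)| = 6 \/ #|G : 'Z(G)| = 9)).
Proof.
move=> e6; have nabG : ~~ abelian G.
  by apply/negP=> /two_cent_abelian; rewrite e6.
have caG : centralizer_abelian G.
  apply: centralizer_abelian_small; rewrite -ltnS -e6.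
  by apply: leq_ltn_trans (card_proper_cents_lt nabG); rewrite leq_addr.
have := card_two_cent nabG caG; rewrite e6.
have [Z1|nZ1] := eqVneq 'Z(G) 1 => /= -[k].
  by left; apply: card_center1_five; rewrite // k addn0.
right; split=> //; apply: index_center_four => //.
by move: k; rewrite addn1 => -[].
Qed.

Theorem theorem4p6 (gT : finGroupType) (G : {group gT}) :
  (two_centralizer 6 G <->
     G \isog 'Alt_('I_4) \/
     ('Z(G) != 1 /\
      (G / 'Z(G) \isog setX (Zp 3) (Zp 3) \/
       G / 'Z(G) \isog 'Sym_('I_3))))
  /\
  (primitive_two_centralizer 6 G <-> G \isog 'Alt_('I_4)).
Proof.
have oQ : #|G / 'Z(G)| = #|G : 'Z(G)| by rewrite card_quotient ?gFnorm.
have Alt6 (rT : finGroupType) (H : {group rT}) :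
    H \isog 'Alt_('I_4) -> #|two_cent H| = 6.
  by case/isog_Alt4_inv=> oH nn3; apply: two_cent_card12.
split; last first.
  split=> [[e6 e6Q] | isoG]; last first.
    split; first exact: Alt6.
    have [oG nn3] := isog_Alt4_inv isoG; rewrite (center1_card12 oG nn3).
    by apply/Alt6/isog_trans/isoG; rewrite isog_sym quotient1_isog.
  case: (two_centralizer6_cases e6) => [[oG nn3] | [nZ1 iG]]; first exact: isog_Alt4.
  rewrite -oQ in iG.
  (* The quotient has order 6 or 9, not 12; and a nontrivial center of index 6 or 9 would give it
     order at least 12. *)
  have [[oQ12 _] | [nZQ iQ]] := two_centralizer6_cases e6Q.
    by case: iG; rewrite oQ12.
  rewrite trivg_card_le1 -ltnNge in nZQ.
  have := Lagrange (center_sub (G / 'Z(G))).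
  by move: nZQ; set z := #|_|; case: iG iQ => -> [] ->; lia.
split=> [e6 | [/Alt6 // | [nZ1 isoQ]]]; last first.
  apply: two_cent_index_6_9; rewrite // -oQ.
  case: isoQ => /card_isog ->; [right | left].
    by rewrite cardsX !card_Zp.
  by rewrite card_Sym card_ord.
case: (two_centralizer6_cases e6) => [[oG nn3] | [nZ1 iG]]; first by left; apply: isog_Alt4.
right; split=> //.
(* A cyclic central quotient would make [G] abelian and the index 1. *)
have ncQ : ~~ cyclic (G / 'Z(G)).
  apply/negP=> /cyclic_center_factor_abelian /center_idP eZ.
  by move: iG; rewrite eZ indexgg => -[].
by case: iG; rewrite -oQ => oQn; [right; apply: isog_Sym3 | left; apply: isog_Z3xZ3].
Qed.
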